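(* Consider the directed path $v_1\to v_2\to v_3$ carrying a \textsc{blocking pebbles} position with only blue and red pebbles, and write $[[p_1,q_1],[p_2,q_2],[p_3,q_3]]$ for the position with $p_i$ blue and $q_i$ red pebbles on $v_i$. Then: (1) for $a\ge 0$ and $b,c\ge 1$, the position $[[a,0],[b,0],[0,c]]$ has value $0$ if $a=0$ and $b=1$, and value $2a+3b-5$ otherwise; (2) for $a,b\ge 1$ and $c\ge 0$, the position $[[a,0],[0,b],[0,c]]$ has value $0$ if $b=1$ and $c=0$; value $-2b-3c+2$ if $a=1$; and value $-2b-3c+4$ otherwise; (3) for $b\ge a\ge 1$, the position $[[a,0],[0,0],[0,b]]$ has value $-3b+2$ if $a=1$; value $\{0\mid -3b+5\}$ if $a=2$; and value $\{2a-6\mid -3b+5\}$ otherwise.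
   Context: \textsc{Blocking pebbles}: a position is a finite directed acyclic graph with, at each vertex, numbers of blue, red and green pebbles (here no green pebbles). An in-neighbour of $v$ is $u$ with an arc $u\to v$; an out-neighbour is $w$ with an arc $v\to w$. Left, from a chosen vertex $v$, either (1) moves a positive number of her pebbles (blue or green) from $v$ to a single in-neighbour of $v$ at no cost, or (2) removes two of her pebbles from $v$ and places one pebble on an out-neighbour of $v$. No blue pebble may be moved onto a vertex currently carrying a red pebble. Right has the symmetric moves with red (and green) pebbles, and no red pebble may be moved onto a vertex carrying a blue pebble. Normal play (last player to move wins). Values are combinatorial game values in Conway's sense. *)

(* Defs.v *)
From Stdlib Require Import Wellfounded FunctionalExtensionality.
From HB Require Import structures.
From mathcomp Require Import all_boot all_order all_algebra zify.

Set Implicit Arguments.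
Unset Strict Implicit.
Unset Printing Implicit Defensive.

(** * Conway games *)

Inductive game : Type :=
  Game (I J : Type) (GL : I -> game) (GR : J -> game).

(* Conway's order: G <= H iff no G^L satisfies H <= G^L and no H^R satisfies
   H^R <= G.  As G and H swap roles in the recursive calls, the two
   propositions (G <= H, H <= G) are computed together, which makes the
   recursion structural; [game_leE] below is Conway's clause. *)
Fixpoint game_cmp (G : game) : game -> Prop * Prop :=
  match G with
  | Game _ _ GL GR =>
    fix cmp_r (H : game) : Prop * Prop :=
      match H with
      | Game _ _ HL HR =>
        ((forall i, ~ (game_cmp (GL i) H).2) /\ (forall j, ~ (cmp_r (HR j)).2),
         (forall i, ~ (cmp_r (HL i)).1) /\ (forall j, ~ (game_cmp (GR j) H).1))
      end
  end.

Definition game_le (G H : game) : Prop := (game_cmp G H).1.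

(* Equality of values. *)
Definition game_eq (G H : game) : Prop := game_le G H /\ game_le H G.

Lemma game_cmp_swap G H :
  ((game_cmp G H).1 <-> (game_cmp H G).2) /\
  ((game_cmp G H).2 <-> (game_cmp H G).1).
Proof.
elim: G H => I J GL IHL GR IHR; elim=> I' J' HL IHL' HR IHR'.
set H := Game HL HR in IHL' IHR' *.
split; split=> -[h1 h2]; split=> k hk.
- by apply: (h1 k); apply/(IHL k H).2.
- by apply: (h2 k); apply/(IHR' k).2.
- by apply: (h1 k); apply/(IHL k H).2.
- by apply: (h2 k); apply/(IHR' k).2.
- by apply: (h1 k); apply/(IHL' k).1.
- by apply: (h2 k); apply/(IHR k H).1.
- by apply: (h1 k); apply/(IHL' k).1.
- by apply: (h2 k); apply/(IHR k H).1.
Qed.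

Lemma game_leE I J I' J' (GL : I -> game) (GR : J -> game)
    (HL : I' -> game) (HR : J' -> game) :
  game_le (Game GL GR) (Game HL HR) <->
  (forall i, ~ game_le (Game HL HR) (GL i)) /\
  (forall j, ~ game_le (HR j) (Game GL GR)).
Proof.
set G := Game GL GR; set H := Game HL HR.
rewrite /game_le; split=> -[h1 h2]; split=> k hk.
- exact: (h1 k ((game_cmp_swap H (GL k)).1.1 hk)).
- exact: (h2 k ((game_cmp_swap (HR k) G).1.1 hk)).
- exact: (h1 k ((game_cmp_swap (GL k) H).2.1 hk)).
- exact: (h2 k ((game_cmp_swap G (HR k)).2.1 hk)).
Qed.

Definition void_options (x : void) : game := match x with end.

(* { G | H } *)
Definition switch (G H : game) : game :=
  Game (fun _ : unit => G) (fun _ : unit => H).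

(* 0 = { | },  n + 1 = { n | },  -(n + 1) = { | -n } *)
Fixpoint nat_game (n : nat) : game :=
  if n is m.+1 then Game (fun _ : unit => nat_game m) void_options
  else Game void_options void_options.

Fixpoint natN_game (n : nat) : game :=
  if n is m.+1 then Game void_options (fun _ : unit => natN_game m)
  else Game void_options void_options.

Definition int_game (z : int) : game :=
  match z with
  | Posz n => nat_game n
  | Negz n => natN_game n.+1
  end.

(** * Blocking pebbles with blue and red pebbles *)

Record dag := Dag {
  vertex :> finType;
  arc : rel vertex;
  dag_acyclic : forall c : seq vertex, cycle arc c -> c = [::] }.

Record position (D : dag) := Position {
  blue : {ffun D -> nat};
  red : {ffun D -> nat} }.

Section Rules.
Variable D : dag.
Implicit Types (own opp : {ffun D -> nat}) (p q : position D) (u v w : D).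

Definition transfer own v k u m : {ffun D -> nat} :=
  [ffun x => own x - (if x == v then k else 0) + (if x == u then m else 0)].

(* A move of the player owning the pebbles [own]; [opp] are the pebbles of the
   opponent, which block, and [own'] are the player's pebbles afterwards. *)
Inductive step own opp : {ffun D -> nat} -> Prop :=
| StepBack v u k of arc u v & 0 < k <= own v & opp u = 0 :
    step own opp (transfer own v k u k)
| StepForth v w of arc v w & 2 <= own v & opp w = 0 :
    step own opp (transfer own v 2 w 1).

Definition left_move p q : Prop :=
  step (blue p) (red p) (blue q) /\ red q = red p.

Definition right_move p q : Prop :=
  step (red p) (blue p) (red q) /\ blue q = blue p.

(* Play terminates: a pebble on v weighs #|D| plus the number of ancestors of
   v, so the weight grows along arcs but never doubles. *)
Definition weight v : nat := #|D| + #|[pred u | (u != v) && connect (@arc D) u v]|.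

Definition pebbles_weight own : nat := \sum_v own v * weight v.

Lemma connect_arc_anti u v : arc u v -> connect (@arc D) v u -> False.
Proof.
move=> uv /connectP[s sp ul].
suff /dag_acyclic : cycle (@arc D) (v :: s) by [].
by rewrite /= rcons_path sp -ul.
Qed.

Lemma weight_arc u v : arc u v -> weight u < weight v.
Proof.
move=> uv; rewrite ltn_add2l; apply: proper_card; apply/properP; split.
  apply/subsetP=> x; rewrite !inE => /andP[xu cxu]; apply/andP; split.
    by apply/eqP=> xv; apply: (connect_arc_anti uv); rewrite -xv.
  exact: connect_trans cxu (connect1 uv).
exists u; rewrite !inE ?eqxx // connect1 // andbT.
by apply/eqP=> uvE; apply: (connect_arc_anti uv); rewrite uvE connect0.
Qed.

Lemma weight_lt2 v w : weight w < 2 * weight v.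
Proof.
have := max_card [pred u | (u != w) && connect (@arc D) u w].
have : #|[pred u | (u != w) && connect (@arc D) u w]| < #|D|.
  rewrite (cardD1 w D) inE add1n ltnS; apply: subset_leq_card.
  by apply/subsetP=> x; rewrite !inE => /andP[-> _].
rewrite /weight; lia.
Qed.

Lemma transfer_weight own v k u m : k <= own v ->
  pebbles_weight (transfer own v k u m) + k * weight v =
  pebbles_weight own + m * weight u.
Proof.
move=> kv; have delta x n : \sum_y (if y == x then n else 0) * weight y = n * weight x.
  rewrite (bigD1 x) //= eqxx big1 ?addn0 // => y /negPf->; exact: mul0n.
rewrite -(delta v k) -(delta u m) /pebbles_weight -!big_split /=.
apply: eq_bigr => x _; rewrite ffunE -!mulnDl; congr (_ * _).
by case: (x =P v) => [->|_]; lia.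
Qed.

Lemma step_weight own opp (own' : {ffun D -> nat}) :
  step own opp own' -> pebbles_weight own' < pebbles_weight own.
Proof.
case=> [v u k uv /andP[k0 kv] _|v w _ kv _].
  have := transfer_weight u k kv; have := weight_arc uv; nia.
have := transfer_weight w 1 kv; have := weight_lt2 v w; lia.
Qed.

Definition option_of q p : Prop := left_move p q \/ right_move p q.

Lemma option_of_wf : well_founded option_of.
Proof.
apply: (@wf_incl _ _ (fun q p => lt
  (pebbles_weight (blue q) + pebbles_weight (red q))
  (pebbles_weight (blue p) + pebbles_weight (red p)))); last first.
  exact: wf_inverse_image PeanoNat.Nat.lt_wf_0.
by move=> q p [] [/step_weight h ->]; lia.
Qed.

Definition game_of_body p (rec : forall q, option_of q p -> game) : game :=
  Game (fun q : {q | left_move p q} => rec (sval q) (or_introl (svalP q)))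
       (fun q : {q | right_move p q} => rec (sval q) (or_intror (svalP q))).

Definition game_of : position D -> game :=
  Fix option_of_wf (fun _ => game) game_of_body.

Lemma game_ofE p : game_of p =
  Game (fun q : {q | left_move p q} => game_of (sval q))
       (fun q : {q | right_move p q} => game_of (sval q)).
Proof.
rewrite /game_of Fix_eq // => x f g fg; rewrite /game_of_body.
by congr Game; apply: functional_extensionality => q.
Qed.

Definition has_value p (G : game) : Prop := game_eq (game_of p) G.

End Rules.

Lemma dipath_acyclic n (c : seq 'I_n) :
  cycle (fun i j : 'I_n => i.+1 == j) c -> c = [::].
Proof.
case: c => // x s /=.
have incr (y : 'I_n) t : path (fun i j : 'I_n => i.+1 == j) y t ->
    y + size t = last y t.
  elim: t y => [|z t IH] y /=; first by rewrite addn0.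
  by case/andP=> /eqP yz /IH <-; rewrite -yz addnS addSn.
by move/incr; rewrite last_rcons size_rcons; lia.
Qed.

(* The directed path on n vertices; v_1, ..., v_n are the ordinals 0, ..., n-1. *)
Definition dipath (n : nat) : dag := Dag (@dipath_acyclic n).

(* [[p1,q1],[p2,q2],[p3,q3]]: each x_i is the pair (blue, red) on v_i. *)
Definition path3_pos (x1 x2 x3 : nat * nat) : position (dipath 3) :=
  Position (D := dipath 3)
    [ffun i : 'I_3 => nth 0 [:: x1.1; x2.1; x3.1] i]
    [ffun i : 'I_3 => nth 0 [:: x1.2; x2.2; x3.2] i].

(* Main.v *)
Require Import Defs.
From mathcomp Require Import all_boot all_order all_algebra zify.

Set Implicit Arguments.
Unset Strict Implicit.
Unset Printing Implicit Defensive.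

(** In the positions of (1) Right cannot move, in those of (2) Left cannot, and
    the same holds in (3) when a = 1.  A game in which only Left has options
    equals the least natural number that no left option reaches, so (1) and (2)
    follow by induction: the best option is always worth exactly one move less,
    and an option that empties v_2 is bad because the opponent can answer to a
    position where he alone can move.  In (3) with a >= 2 both players fight
    for v_2, and moving a single pebble there is their best option. *)

(** * Games *)

(* Transitivity for (G, H, K) calls it on a cyclic rotation of the triple with one
   member replaced by an option, so the three rotations are proved together. *)
Lemma game_le_cyc G H K :
  [/\ game_le G H -> game_le H K -> game_le G K,
      game_le H K -> game_le K G -> game_le H G
    & game_le K G -> game_le G H -> game_le K H].
Proof.
elim: G H K => I J GL IHL GR IHR; elim=> I' J' HL IHL' HR IHR'.
elim=> I'' J'' KL IHL'' KR IHR''.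
split=> le1 le2; have /game_leE[l1 r1] := le1; have /game_leE[l2 r2] := le2;
  apply/game_leE; split=> i le3.
- by apply: (l1 i); case: (IHL i (Game HL HR) (Game KL KR)) => _ + _; apply.
- by apply: (r2 i); case: (IHR'' i) => _ _; apply.
- by apply: (l1 i); case: (IHL' i (Game KL KR)) => _ _; apply.
- by apply: (r2 i); case: (IHR i (Game HL HR) (Game KL KR)) => + _ _; apply.
- by apply: (l1 i); case: (IHL'' i) => + _ _; apply.
- by apply: (r2 i); case: (IHR' i (Game KL KR)) => _ + _; apply.
Qed.

Lemma game_le_trans H G K : game_le G H -> game_le H K -> game_le G K.
Proof. by case: (game_le_cyc G H K). Qed.

Lemma left_option_nle I J (GL : I -> game) (GR : J -> game) i H :
  game_le H (GL i) -> ~ game_le (Game GL GR) H.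
Proof. by case: H => I' J' HL HR leH /game_leE[/(_ i) []]. Qed.

Lemma right_option_nge I J (GL : I -> game) (GR : J -> game) j H :
  game_le (GR j) H -> ~ game_le H (Game GL GR).
Proof. by case: H => I' J' HL HR leH /game_leE[_ /(_ j) []]. Qed.

Lemma game_le_refl G : game_le G G.
Proof.
elim: G => I J GL IHL GR IHR; apply/game_leE; split=> i.
  exact: left_option_nle (IHL i).
exact: right_option_nge (IHR i).
Qed.

Lemma nat_game_le m n : m <= n -> game_le (nat_game m) (nat_game n).
Proof.
elim: n m => [|n IHn] [|m] // le_mn; apply/game_leE; split=> -[] //.
exact: (@left_option_nle _ _ _ _ tt _ (IHn _ _)).
Qed.

Lemma nat_gameS_nle n : ~ game_le (nat_game n.+1) (nat_game n).
Proof. exact: (@left_option_nle _ _ _ _ tt _ (game_le_refl _)). Qed.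

Lemma natN_game_le m n : m <= n -> game_le (natN_game n) (natN_game m).
Proof.
elim: n m => [|n IHn] [|m] // le_mn; apply/game_leE; split=> -[] //.
exact: (@right_option_nge _ _ _ _ tt _ (IHn _ _)).
Qed.

Lemma natN_gameS_nle n : ~ game_le (natN_game n) (natN_game n.+1).
Proof. exact: (@right_option_nge _ _ _ _ tt _ (game_le_refl _)). Qed.

Lemma game_le_nat_nge G m n :
  m < n -> game_le G (nat_game m) -> ~ game_le (nat_game n) G.
Proof.
move=> lt_mn leG geG; apply: (@nat_gameS_nle m).
exact: game_le_trans (nat_game_le lt_mn) (game_le_trans geG leG).
Qed.

Lemma game_ge_natN_nle G m n :
  m < n -> game_le (natN_game m) G -> ~ game_le G (natN_game n).
Proof.
move=> lt_mn geG leG; apply: (@natN_gameS_nle m).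
exact: game_le_trans (game_le_trans geG leG) (natN_game_le lt_mn).
Qed.

(** At n = 0 both sides are the same game: [nat_game 0] and [natN_game 0] are convertible. *)
Lemma int_game_opp n : int_game (- n%:Z)%R = natN_game n.
Proof. by case: n. Qed.

(** * Positions *)

Section Positions.
Variable D : dag.
Implicit Types p q : position D.

Lemma left_move_nle p q G :
  left_move p q -> game_le G (game_of q) -> ~ game_le (game_of p) G.
Proof.
by move=> mv leG; rewrite game_ofE; apply: (left_option_nle (i := exist _ q mv)).
Qed.

Lemma right_move_nge p q G :
  right_move p q -> game_le (game_of q) G -> ~ game_le G (game_of p).
Proof.
by move=> mv leG; rewrite game_ofE; apply: (right_option_nge (j := exist _ q mv)).
Qed.

(** The second hypothesis gives the upper bound, the third the lower one. Left options need only
    fail to reach [n], since some of them are switches rather than numbers. *)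
Lemma has_value_nat p n :
    (forall q, ~ right_move p q) ->
    (forall q, left_move p q -> ~ game_le (nat_game n) (game_of q)) ->
    (0 < n -> exists2 q, left_move p q & game_le (nat_game n.-1) (game_of q)) ->
  has_value p (nat_game n).
Proof.
move=> noR ltL geL; split; rewrite game_ofE.
  case: n ltL {geL} => [|n] ltL; apply/game_leE;
    by split=> [[q mv]|[]]; apply: ltL.
case: n geL {ltL} => [|n] geL; apply/game_leE;
  split=> [[]|[q mv]] //; try by case: (noR q mv).
have [q mv le_q] := geL isT; rewrite -game_ofE.
exact: left_move_nle mv le_q.
Qed.

Lemma has_value_natN p n :
    (forall q, ~ left_move p q) ->
    (forall q, right_move p q -> ~ game_le (game_of q) (natN_game n)) ->
    (0 < n -> exists2 q, right_move p q & game_le (game_of q) (natN_game n.-1)) ->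
  has_value p (natN_game n).
Proof.
move=> noL gtR leR; split; rewrite game_ofE.
  case: n leR {gtR} => [|n] leR; apply/game_leE;
    split=> [[q mv]|[]] //; try by case: (noL q mv).
  have [q mv le_q] := leR isT; rewrite -game_ofE.
  exact: right_move_nge mv le_q.
case: n gtR {leR} => [|n] gtR; apply/game_leE;
  by split=> [[]|[q mv]]; apply: gtR.
Qed.

(** Each player has an option attaining the bound that dominates all of that player's other
    options. *)
Lemma has_value_switch p G H :
    (forall q, left_move p q -> game_le (game_of q) G) ->
    (exists2 q, left_move p q & game_le G (game_of q)) ->
    (forall q, right_move p q -> game_le H (game_of q)) ->
    (exists2 q, right_move p q & game_le (game_of q) H) ->
  has_value p (switch G H).
Proof.
move=> leL [ql mvl geL] geR [qr mvr leR]; split; rewrite game_ofE;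
  apply/game_leE; split.
- by move=> [q mv] /=; apply: (left_option_nle (i := tt)); apply: leL.
- by move=> _ /=; rewrite -game_ofE; apply: right_move_nge mvr leR.
- by move=> _ /=; rewrite -game_ofE; apply: left_move_nle mvl geL.
- by move=> [q mv] /=; apply: (right_option_nge (j := tt)); apply: geR.
Qed.

Lemma no_left_move_le0 p :
  (forall q, ~ left_move p q) -> game_le (game_of p) (nat_game 0).
Proof.
by move=> noL; rewrite game_ofE; apply/game_leE; split=> [[q mv]|[]]; case: (noL q).
Qed.

Lemma no_right_move_ge0 p :
  (forall q, ~ right_move p q) -> game_le (nat_game 0) (game_of p).
Proof.
by move=> noR; rewrite game_ofE; apply/game_leE; split=> [[]|[q mv]]; case: (noR q).
Qed.

End Positions.

(** * The path on three vertices *)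

(** Convertible with both fields of [path3_pos], so one analysis of steps serves both players. *)
Definition pebbles3 (x1 x2 x3 : nat) : {ffun dipath 3 -> nat} :=
  [ffun i : 'I_3 => nth 0 [:: x1; x2; x3] i].

(* [x] are the pebbles of the player to move, [y] those of the opponent. *)
Inductive step3 (x1 x2 x3 y1 y2 y3 : nat) : nat -> nat -> nat -> Prop :=
| Back21 k of 0 < k <= x2 & y1 = 0 : step3 x1 x2 x3 y1 y2 y3 (x1 + k) (x2 - k) x3
| Back32 k of 0 < k <= x3 & y2 = 0 : step3 x1 x2 x3 y1 y2 y3 x1 (x2 + k) (x3 - k)
| Forth12 of 2 <= x1 & y2 = 0 : step3 x1 x2 x3 y1 y2 y3 (x1 - 2) x2.+1 x3
| Forth23 of 2 <= x2 & y3 = 0 : step3 x1 x2 x3 y1 y2 y3 x1 (x2 - 2) x3.+1.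

Lemma forall_ord3 (P : 'I_3 -> Prop) :
  P (inord 0) -> P (inord 1) -> P (inord 2) -> forall i, P i.
Proof.
move=> P0 P1 P2 i; rewrite -[i]inord_val.
by case: i => [] [|[|[|]]].
Qed.

Lemma pebbles3E x1 x2 x3 (f : {ffun dipath 3 -> nat}) :
  f (inord 0 : 'I_3) = x1 -> f (inord 1 : 'I_3) = x2 -> f (inord 2 : 'I_3) = x3 ->
  f = pebbles3 x1 x2 x3.
Proof.
by move=> f1 f2 f3; apply/ffunP; apply: forall_ord3; rewrite ffunE inordK.
Qed.

Lemma step_pebbles3 x1 x2 x3 y1 y2 y3 (own' : {ffun dipath 3 -> nat}) :
  step (pebbles3 x1 x2 x3) (pebbles3 y1 y2 y3) own' <->
  exists z1 z2 z3,
    step3 x1 x2 x3 y1 y2 y3 z1 z2 z3 /\ own' = pebbles3 z1 z2 z3.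
Proof.
have ordE (i j : nat) : i < 3 -> j < 3 ->
    ((inord i : dipath 3) == (inord j : dipath 3)) = (i == j).
  by move=> i3 j3; rewrite -val_eqE /= !inordK.
split=> [|[z1 [z2 [z3 [+ ->]]]]].
  case=> [v u k uv kv yu|v w vw xv yw].
    (* Of the nine pairs of vertices, only the arcs from v_1 to v_2 and from v_2 to v_3 survive. *)
    elim/forall_ord3: v uv kv => uv; rewrite ffunE inordK //= => kv;
    elim/forall_ord3: u uv yu => /= /eqP; rewrite !inordK // => _;
    rewrite ffunE inordK //= => yu.
    + exists (x1 + k), (x2 - k), x3; split; first exact: Back21.
      by apply: pebbles3E; rewrite !ffunE !ordE // !inordK //=; lia.
    + exists x1, (x2 + k), (x3 - k); split; first exact: Back32.
      by apply: pebbles3E; rewrite !ffunE !ordE // !inordK //=; lia.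
  elim/forall_ord3: v vw xv => vw; rewrite ffunE inordK //= => xv;
  elim/forall_ord3: w vw yw => /= /eqP; rewrite !inordK // => _;
  rewrite ffunE inordK //= => yw.
  + exists (x1 - 2), x2.+1, x3; split; first exact: Forth12.
    by apply: pebbles3E; rewrite !ffunE !ordE // !inordK //=; lia.
  + exists x1, (x2 - 2), x3.+1; split; first exact: Forth23.
    by apply: pebbles3E; rewrite !ffunE !ordE // !inordK //=; lia.
have arc3 i : i.+1 < 3 -> Defs.arc (inord i : dipath 3) (inord i.+1 : dipath 3).
  by move=> i3; apply/eqP; rewrite !inordK // ltnW.
have pebE t1 t2 t3 i : i < 3 ->
    pebbles3 t1 t2 t3 (inord i : 'I_3) = nth 0 [:: t1; t2; t3] i.
  by move=> i3; rewrite ffunE inordK.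
case=> [k kx y0|k kx y0|kx y0|kx y0].
(* In each case the target triple is folded back into a [transfer], so that the constructor applies;
   the three coordinates are checked afterwards. *)
- (rewrite -(@pebbles3E (x1 + k) (x2 - k) x3 (transfer (pebbles3 x1 x2 x3)
    (inord 1 : dipath 3) k (inord 0 : dipath 3) k));
    first by apply: StepBack; rewrite ?arc3 ?pebE);
  by rewrite ffunE !ordE // pebE //=; lia.
- (rewrite -(@pebbles3E x1 (x2 + k) (x3 - k) (transfer (pebbles3 x1 x2 x3)
    (inord 2 : dipath 3) k (inord 1 : dipath 3) k));
    first by apply: StepBack; rewrite ?arc3 ?pebE);
  by rewrite ffunE !ordE // pebE //=; lia.
- (rewrite -(@pebbles3E (x1 - 2) x2.+1 x3 (transfer (pebbles3 x1 x2 x3)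
    (inord 0 : dipath 3) 2 (inord 1 : dipath 3) 1));
    first by apply: StepForth; rewrite ?arc3 ?pebE);
  by rewrite ffunE !ordE // pebE //=; lia.
- (rewrite -(@pebbles3E x1 (x2 - 2) x3.+1 (transfer (pebbles3 x1 x2 x3)
    (inord 1 : dipath 3) 2 (inord 2 : dipath 3) 1));
    first by apply: StepForth; rewrite ?arc3 ?pebE);
  by rewrite ffunE !ordE // pebE //=; lia.
Qed.

Lemma left_move_path3 x1 y1 x2 y2 x3 y3 q :
  left_move (path3_pos (x1, y1) (x2, y2) (x3, y3)) q <->
  exists z1 z2 z3, step3 x1 x2 x3 y1 y2 y3 z1 z2 z3 /\
    q = path3_pos (z1, y1) (z2, y2) (z3, y3).
Proof.
split=> [[/step_pebbles3[z1 [z2 [z3 [st bl]]]] re]|[z1 [z2 [z3 [st ->]]]]].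
  by exists z1, z2, z3; split=> //; case: q bl re => /= ? ? -> ->.
by split=> //; apply/step_pebbles3; exists z1, z2, z3.
Qed.

Lemma right_move_path3 x1 y1 x2 y2 x3 y3 q :
  right_move (path3_pos (x1, y1) (x2, y2) (x3, y3)) q <->
  exists z1 z2 z3, step3 y1 y2 y3 x1 x2 x3 z1 z2 z3 /\
    q = path3_pos (x1, z1) (x2, z2) (x3, z3).
Proof.
split=> [[/step_pebbles3[z1 [z2 [z3 [st re]]]] bl]|[z1 [z2 [z3 [st ->]]]]].
  by exists z1, z2, z3; split=> //; case: q bl re => /= ? ? -> ->.
by split=> //; apply/step_pebbles3; exists z1, z2, z3.
Qed.

(** * Values of the positions on the path *)

Lemma no_right_move_v2_blue a b c q :
  0 < b -> ~ right_move (path3_pos (a, 0) (b, 0) (0, c)) q.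
(* All red pebbles lie on the sink v_3, whose only neighbour v_2 is blocked by blue. *)
Proof. by move=> b0 /right_move_path3[? [? [? [[]]]]]; lia. Qed.

Lemma no_left_move_v2_red a b c q :
  0 < b -> ~ left_move (path3_pos (a, 0) (0, b) (0, c)) q.
Proof. by move=> b0 /left_move_path3[? [? [? [[]]]]]; lia. Qed.

(** Right replies by moving one pebble back onto v_2; Left is then stuck, so this right option is at
    most 0. *)
Lemma v2_empty_nge_nat a c n : 0 < c ->
  ~ game_le (nat_game n) (game_of (path3_pos (a, 0) (0, 0) (0, c))).
Proof.
move=> c0; apply: (@right_move_nge _ _ (path3_pos (a, 0) (0, 1) (0, c - 1))).
  by apply/right_move_path3; exists 0, 1, (c - 1); split=> //; apply: Back32.
apply: game_le_trans (@nat_game_le 0 n isT).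
by apply: no_left_move_le0 => q; apply: no_left_move_v2_red.
Qed.

(** Left replies by moving forward onto v_2, which leaves Right stuck. *)
Lemma v2_empty_nle_natN a c n : 2 <= a ->
  ~ game_le (game_of (path3_pos (a, 0) (0, 0) (0, c))) (natN_game n).
Proof.
move=> a2; apply: (@left_move_nle _ _ (path3_pos (a - 2, 0) (1, 0) (0, c))).
  by apply/left_move_path3; exists (a - 2), 1, 0; split=> //; apply: Forth12.
apply: game_le_trans (@natN_game_le 0 n isT) _.
by apply: no_right_move_ge0 => q; apply: no_right_move_v2_blue.
Qed.

(* Truncated subtraction absorbs the exceptional value 0 at a = 0, b = 1. *)
Lemma value_v2_blue a b c : 0 < b -> 0 < c ->
  has_value (path3_pos (a, 0) (b, 0) (0, c)) (nat_game (2 * a + 3 * b - 5)).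
Proof.
(* Moving k pebbles back lowers 2a + 3b by k, and a move forward from v_1 lowers it by 1. *)
move=> + c0; have [n] := ubnP (2 * a + 3 * b).
elim: n => // n IHn in a b * => lt_n b0.
apply: has_value_nat => [q|q|gt0]; first exact: no_right_move_v2_blue.
  move=> /left_move_path3[z1 [z2 [z3 [+ ->]]]].
  case=> [k /andP[k0 kb] _|k|a2 _|_]; try lia.
    have [->|ltkb] : k = b \/ k < b by lia.
      by rewrite subnn; apply: v2_empty_nge_nat.
    have [||le_q _] := IHn (a + k) (b - k); try lia.
    by apply: game_le_nat_nge le_q; lia.
  have [||le_q _] := IHn (a - 2) b.+1; try lia.
  by apply: game_le_nat_nge le_q; lia.
(* The best move keeps v_2 occupied: a lone pebble there must stay, and [gt0] then provides the two
   pebbles on v_1 for a forward move. *)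
have [b1|b2] : b = 1 \/ 2 <= b by lia.
  exists (path3_pos (a - 2, 0) (b.+1, 0) (0, c)).
    apply/left_move_path3; exists (a - 2), b.+1, 0; split=> //.
    by apply: Forth12 => //; lia.
  have [||_] := IHn (a - 2) b.+1; try lia.
  by apply: game_le_trans; apply: nat_game_le; lia.
exists (path3_pos (a + 1, 0) (b - 1, 0) (0, c)).
  by apply/left_move_path3; exists (a + 1), (b - 1), 0; split=> //; apply: Back21.
have [||_] := IHn (a + 1) (b - 1); try lia.
by apply: game_le_trans; apply: nat_game_le; lia.
Qed.

(** A single blue pebble on the source v_1 can never move, so Right plays alone. Red pebbles weigh 2
    on v_2 and 3 on v_3; the best moves lower the total by 1 until one pebble is left on v_2.
    Allowing b = 0 also covers (3) with a = 1. *)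
Lemma value_v1_single b c : 0 < b + c ->
  has_value (path3_pos (1, 0) (0, b) (0, c)) (natN_game (2 * b + 3 * c - 2)).
Proof.
have [n] := ubnP (2 * b + 3 * c).
elim: n => // n IHn in b c * => lt_n bc0.
apply: has_value_natN => [q|q|gt0].
- by move=> /left_move_path3[? [? [? [[]]]]]; lia.
- move=> /right_move_path3[z1 [z2 [z3 [+ ->]]]].
  case=> [k|k /andP[k0 kc] _||b2 _]; try lia.
    have [||_ ge_q] := IHn (b + k) (c - k); try lia.
    by apply: game_ge_natN_nle ge_q; lia.
  have [||_ ge_q] := IHn (b - 2) c.+1; try lia.
  by apply: game_ge_natN_nle ge_q; lia.
have [c0|c0] : c = 0 \/ 0 < c by lia.
  exists (path3_pos (1, 0) (0, b - 2) (0, c.+1)).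
    apply/right_move_path3; exists 0, (b - 2), c.+1; split=> //.
    by apply: Forth23 => //; lia.
  have [||+ _] := IHn (b - 2) c.+1; try lia.
  by move=> le_q; apply: game_le_trans le_q _; apply: natN_game_le; lia.
exists (path3_pos (1, 0) (0, b + 1) (0, c - 1)).
  by apply/right_move_path3; exists 0, (b + 1), (c - 1); split=> //; apply: Back32.
have [||+ _] := IHn (b + 1) (c - 1); try lia.
by move=> le_q; apply: game_le_trans le_q _; apply: natN_game_le; lia.
Qed.

(* Truncated subtraction absorbs the exceptional value 0 at b = 1, c = 0. *)
Lemma value_v2_red a b c : 2 <= a -> 0 < b ->
  has_value (path3_pos (a, 0) (0, b) (0, c)) (natN_game (2 * b + 3 * c - 4)).
Proof.
move=> a2; have [n] := ubnP (2 * b + 3 * c).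
elim: n => // n IHn in b c * => lt_n b0.
apply: has_value_natN => [q|q|gt0]; first exact: no_left_move_v2_red.
  move=> /right_move_path3[z1 [z2 [z3 [+ ->]]]].
  case=> [k|k /andP[k0 kc] _||b2 _]; try lia.
    have [||_ ge_q] := IHn (b + k) (c - k); try lia.
    by apply: game_ge_natN_nle ge_q; lia.
  (* With b = 2 the forward move empties v_2 and lets Left in. *)
  have [->|b3] : b = 2 \/ 3 <= b by lia.
    exact: v2_empty_nle_natN.
  have [||_ ge_q] := IHn (b - 2) c.+1; try lia.
  by apply: game_ge_natN_nle ge_q; lia.
(* If c = 0 then [gt0] forces b >= 3, so the forward move still leaves a red pebble on v_2. *)
have [c0|c0] : c = 0 \/ 0 < c by lia.
  exists (path3_pos (a, 0) (0, b - 2) (0, c.+1)).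
    apply/right_move_path3; exists 0, (b - 2), c.+1; split=> //.
    by apply: Forth23 => //; lia.
  have [||+ _] := IHn (b - 2) c.+1; try lia.
  by move=> le_q; apply: game_le_trans le_q _; apply: natN_game_le; lia.
exists (path3_pos (a, 0) (0, b + 1) (0, c - 1)).
  by apply/right_move_path3; exists 0, (b + 1), (c - 1); split=> //; apply: Back32.
have [||+ _] := IHn (b + 1) (c - 1); try lia.
by move=> le_q; apply: game_le_trans le_q _; apply: natN_game_le; lia.
Qed.

(** Left's only move leads to a - 2 pebbles on v_1 and one on v_2. Right moves k pebbles back,
    reaching -(3b - k - 4), which is best for Right at k = 1. *)
Lemma value_v2_empty a b : 2 <= a -> 2 <= b ->
  has_value (path3_pos (a, 0) (0, 0) (0, b))
    (switch (nat_game (2 * a - 6)) (natN_game (3 * b - 5))).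
Proof.
move=> a2 b2.
have [||leL geL] := @value_v2_blue (a - 2) 1 b; try lia.
have EL : 2 * (a - 2) + 3 * 1 - 5 = 2 * a - 6 by lia.
rewrite {}EL in leL geL.
apply: has_value_switch.
- move=> q /left_move_path3[z1 [z2 [z3 [+ ->]]]].
  by case=> [k|k|_ _|]; try lia.
- exists (path3_pos (a - 2, 0) (1, 0) (0, b)) => //.
  by apply/left_move_path3; exists (a - 2), 1, 0; split=> //; apply: Forth12.
- move=> q /right_move_path3[z1 [z2 [z3 [+ ->]]]].
  case=> [k|k /andP[k0 kb] _||]; try lia.
  have [||_] := @value_v2_red a (0 + k) (b - k); try lia.
  by apply: game_le_trans; apply: natN_game_le; lia.
exists (path3_pos (a, 0) (0, 1) (0, b - 1)).
  apply/right_move_path3; exists 0, 1, (b - 1); split=> //.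
  by apply: Back32 => //; lia.
have [||+ _] := @value_v2_red a 1 (b - 1); try lia.
by move=> le_q; apply: game_le_trans le_q _; apply: natN_game_le; lia.
Qed.

(** * Translation to integer values *)

Local Open Scope ring_scope.

Theorem theorem5 :
  (forall a b c : nat, (1 <= b)%N -> (1 <= c)%N ->
     has_value (path3_pos (a, 0%N) (b, 0%N) (0%N, c))
       (int_game (if (a == 0%N) && (b == 1%N) then 0
                  else 2 * a%:Z + 3 * b%:Z - 5)))
  /\
  (forall a b c : nat, (1 <= a)%N -> (1 <= b)%N ->
     has_value (path3_pos (a, 0%N) (0%N, b) (0%N, c))
       (int_game (if (b == 1%N) && (c == 0%N) then 0
                  else if a == 1%N then - 2 * b%:Z - 3 * c%:Z + 2
                  else - 2 * b%:Z - 3 * c%:Z + 4)))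
  /\
  (forall a b : nat, (1 <= a)%N -> (a <= b)%N ->
     has_value (path3_pos (a, 0%N) (0%N, 0%N) (0%N, b))
       (if a == 1%N then int_game (- 3 * b%:Z + 2)
        else if a == 2%N then switch (int_game 0) (int_game (- 3 * b%:Z + 5))
        else switch (int_game (2 * a%:Z - 6)) (int_game (- 3 * b%:Z + 5)))).
Proof.
split; [|split].
- move=> a b c b0 c0; set z := (if _ then _ else _).
  (* As b >= 1, the integer 2a + 3b - 5 is negative only at a = 0, b = 1, the exceptional case. *)
  have -> : z = (2 * a + 3 * b - 5)%N%:Z by rewrite /z; case: ifP; lia.
  exact: value_v2_blue.
- move=> a b c a0 b0; set z := (if _ then _ else _).
  have [a1|a2] : (a = 1 \/ 2 <= a)%N by lia.
    have -> : z = - (2 * b + 3 * c - 2)%N%:Z.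
      by rewrite /z a1 eqxx; case: ifP; lia.
    by rewrite int_game_opp a1; apply: value_v1_single; lia.
  have -> : z = - (2 * b + 3 * c - 4)%N%:Z.
    by rewrite /z (gtn_eqF a2); case: ifP; lia.
  by rewrite int_game_opp; apply: value_v2_red.
move=> a b a0 ab; case: (a =P 1%N) => [->|a1].
  (* The term 2 * 0 stands for the empty v_2 in [value_v1_single]. *)
  have -> : - 3 * b%:Z + 2 = - (2 * 0 + 3 * b - 2)%N%:Z by lia.
  by rewrite int_game_opp; apply: value_v1_single; lia.
have -> : - 3 * b%:Z + 5 = - (3 * b - 5)%N%:Z by lia.
have val : has_value (path3_pos (a, 0%N) (0%N, 0%N) (0%N, b))
    (switch (nat_game (2 * a - 6)) (natN_game (3 * b - 5))).
  by apply: value_v2_empty; lia.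
rewrite int_game_opp; case: (a =P 2%N) => [a2|a2].
  (* At a = 2 the truncated 2a - 6 computes to 0. *)
  by move: val; rewrite {2}a2.
have -> : 2 * a%:Z - 6 = (2 * a - 6)%N%:Z by lia.
exact: val.
Qed.
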